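(* Let $m\ge 1$, $n\ge 0$ be integers and $\mu\in\mathbb{C}$. The linear map $\varphi:\mathfrak{gl}_{m|n}(\mathbb{C})\to\mathfrak{gl}(W)$ given by $\varphi(E_{i,j})=e_{i,j}$ for $i,j=1,\dots,m+n$, where $W$ and the operators $e_{i,j}$ on $W$ (depending on $\mu$) are as defined in the context, is a Lie superalgebra homomorphism. That is, $W$ is a $\mathfrak{gl}_{m|n}(\mathbb{C})$-module.
   Context: All vector spaces and algebras are over $\mathbb{C}$. For $1\le i\le m+n$ put $|i|=0$ if $i\le m$ and $|i|=1$ otherwise. $\mathfrak{gl}_{m|n}(\mathbb{C})$ is the general linear Lie superalgebra of $(m+n)\times(m+n)$ matrices, with matrix units $E_{i,j}$ of parity $|i|+|j|$ and the supercommutator as bracket. $W$ is the associative algebra generated by $x_2,\dots,x_m,y_1,\dots,y_n$ subject to $x_ix_j=x_jx_i$, $x_iy_k=y_kx_i$, $y_ky_l=-y_ly_k$ (so $W\cong\mathbb{C}[x_2,\dots,x_m]\otimes\bigwedge^*(\mathbb{C}y_1\oplus\cdots\oplus\mathbb{C}y_n)$). $W$ is a superalgebra with $x_i$ even and $y_k$ odd, and $\mathfrak{gl}(W)$ denotes the Lie superalgebra of linear endomorphisms of $W$ with the supercommutator. $\frac{\partial}{\partial x_i}$ (even) and $\frac{\partial}{\partial y_k}$ (odd) are the partial differential operators on $W$; together with the multiplication operators they satisfy $[\frac{\partial}{\partial x_i},x_j]=\delta_{i,j}$, $\frac{\partial}{\partial y_k}y_l+y_l\frac{\partial}{\partial y_k}=\delta_{k,l}$,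 $\frac{\partial}{\partial y_k}\frac{\partial}{\partial y_l}+\frac{\partial}{\partial y_l}\frac{\partial}{\partial y_k}=0$, all other pairs commuting (except that the $y$'s anticommute), and they kill $1$. The operators on $W$ are, for $i,j=2,\dots,m$ and $k,l=1,\dots,n$: $e_{1,1}=\mu-\sum_{s=2}^m x_s\frac{\partial}{\partial x_s}-\sum_{t=1}^n y_t\frac{\partial}{\partial y_t}$, $e_{i,1}=x_i$, $e_{m+k,1}=y_k$, $e_{1,i}=e_{1,1}\frac{\partial}{\partial x_i}$, $e_{1,m+k}=e_{1,1}\frac{\partial}{\partial y_k}$, $e_{i,j}=x_i\frac{\partial}{\partial x_j}$, $e_{i,m+k}=x_i\frac{\partial}{\partial y_k}$, $e_{m+k,i}=y_k\frac{\partial}{\partial x_i}$, $e_{m+k,m+l}=y_k\frac{\partial}{\partial y_l}$. *)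

(* Defs.v *)
From HB Require Import structures.
From mathcomp Require Import all_boot all_order all_algebra.
From mathcomp Require Import generic_quotient.
From mathcomp Require Import boolp functions reals.
From mathcomp Require Export complex.

Set Implicit Arguments.
Unset Strict Implicit.
Unset Printing Implicit Defensive.

Import GRing.Theory.
Local Open Scope ring_scope.
Local Open Scope quotient_scope.

(* Indices are 0-based: the 'I_m-valued index i stands for i + 1, so the       *)
(* generators x_2, ..., x_m are indexed by the nonzero elements of 'I_m.       *)
Notation even_idx m := {i : 'I_m | (0 < i)%N}.
Notation gen m n := (even_idx m + 'I_n)%type.

Definition gpar (m n : nat) (g : gen m n) : bool :=
  if g is inr _ then true else false.

Inductive Wexpr (K : Type) (m n : nat) : Type :=
  | WGen of gen m n
  | WCst of K
  | WAdd of Wexpr K m n & Wexpr K m n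
  | WMul of Wexpr K m n & Wexpr K m n.

Arguments WGen {K m n}.
Arguments WCst {K} m n.

HB.instance Definition _ (K : Type) (m n : nat) := gen_eqMixin (Wexpr K m n).
HB.instance Definition _ (K : Type) (m n : nat) :=
  gen_choiceMixin (Wexpr K m n).

(* The least congruence for which the quotient is an associative unital        *)
(* K-algebra satisfying the three families of relations WxxC, WxyC, WyyN.      *)
Inductive Wcong (K : comNzRingType) (m n : nat) :
    Wexpr K m n -> Wexpr K m n -> Prop :=
  | Wrefl a : Wcong a a
  | Wsym a b : Wcong a b -> Wcong b a
  | Wtrans a b c : Wcong a b -> Wcong b c -> Wcong a c
  | WcongD a a' b b' : Wcong a a' -> Wcong b b' -> Wcong (WAdd a b) (WAdd a' b')
  | WcongM a a' b b' : Wcong a a' -> Wcong b b' -> Wcong (WMul a b) (WMul a' b')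
  | WaddA a b c : Wcong (WAdd a (WAdd b c)) (WAdd (WAdd a b) c)
  | WaddC a b : Wcong (WAdd a b) (WAdd b a)
  | Wadd0 a : Wcong (WAdd (WCst m n 0) a) a
  | WaddN a : Wcong (WAdd (WMul (WCst m n (-1)) a) a) (WCst m n 0)
  | WmulA a b c : Wcong (WMul a (WMul b c)) (WMul (WMul a b) c)
  | Wmul1 a : Wcong (WMul (WCst m n 1) a) a
  | WmulDl a b c : Wcong (WMul (WAdd a b) c) (WAdd (WMul a c) (WMul b c))
  | WmulDr a b c : Wcong (WMul a (WAdd b c)) (WAdd (WMul a b) (WMul a c))
  | WcstD s t : Wcong (WCst m n (s + t)) (WAdd (WCst m n s) (WCst m n t))
  | WcstM s t : Wcong (WCst m n (s * t)) (WMul (WCst m n s) (WCst m n t))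
  | WcstC s a : Wcong (WMul (WCst m n s) a) (WMul a (WCst m n s))
  | WxxC (i j : even_idx m) :
      Wcong (WMul (WGen (inl i)) (WGen (inl j)))
            (WMul (WGen (inl j)) (WGen (inl i)))
  | WxyC (i : even_idx m) (k : 'I_n) :
      Wcong (WMul (WGen (inl i)) (WGen (inr k)))
            (WMul (WGen (inr k)) (WGen (inl i)))
  | WyyN (k l : 'I_n) :
      Wcong (WMul (WGen (inr k)) (WGen (inr l)))
            (WMul (WCst m n (-1)) (WMul (WGen (inr l)) (WGen (inr k)))).

Section WQuotient.
Variables (K : comNzRingType) (m n : nat).
Local Notation expr := (Wexpr K m n).
Local Notation cst := (@WCst K m n).

Definition Wequiv : rel expr := fun a b => `[< Wcong a b >].

Lemma Wequiv_is_equiv : equiv_class_of Wequiv.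
Proof.
split=> [a|a b|b a c].
- exact/asboolP/Wrefl.
- by apply/asboolP/asboolP; apply: Wsym.
- by move=> /asboolP ab /asboolP bc; apply/asboolP; apply: Wtrans ab bc.
Qed.

Canonical Wequiv_equiv := EquivRelPack Wequiv_is_equiv.

Definition W := {eq_quot Wequiv}.
HB.instance Definition _ := Choice.on W.
HB.instance Definition _ := EqQuotient.on W.

Definition Wpi (a : expr) : W := \pi_W a.

Lemma WpiP a b : Wcong a b -> Wpi a = Wpi b.
Proof. by move=> ab; apply/eqmodP/asboolP. Qed.

Lemma Wpi_cong a b : Wpi a = Wpi b -> Wcong a b.
Proof. by move/eqmodP/asboolP. Qed.

Lemma WreprK (w : W) : Wpi (repr w) = w.
Proof. exact: reprK. Qed.

Lemma Wrepr_cong a : Wcong (repr (Wpi a)) a.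
Proof. by apply: Wpi_cong; rewrite WreprK. Qed.

Definition Wzero : W := Wpi (cst 0).
Definition Wone : W := Wpi (cst 1).
Definition Wadd (u v : W) : W := Wpi (WAdd (repr u) (repr v)).
Definition Wmul (u v : W) : W := Wpi (WMul (repr u) (repr v)).
Definition Wopp (u : W) : W := Wpi (WMul (cst (-1)) (repr u)).
Definition Wscale (s : K) (u : W) : W := Wpi (WMul (cst s) (repr u)).

Lemma WaddE a b : Wadd (Wpi a) (Wpi b) = Wpi (WAdd a b).
Proof. by apply/WpiP/WcongD; apply: Wrepr_cong. Qed.
Lemma WmulE a b : Wmul (Wpi a) (Wpi b) = Wpi (WMul a b).
Proof. by apply/WpiP/WcongM; apply: Wrepr_cong. Qed.
Lemma WoppE a : Wopp (Wpi a) = Wpi (WMul (cst (-1)) a).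
Proof. by apply/WpiP/WcongM; [apply: Wrefl|apply: Wrepr_cong]. Qed.
Lemma WscaleE s a : Wscale s (Wpi a) = Wpi (WMul (cst s) a).
Proof. by apply/WpiP/WcongM; [apply: Wrefl|apply: Wrepr_cong]. Qed.

Lemma Wind (P : W -> Prop) : (forall a, P (Wpi a)) -> forall w, P w.
Proof. by move=> Pa w; rewrite -(WreprK w). Qed.

Fact Waddr_assoc : associative Wadd.
Proof.
by elim/Wind=> a; elim/Wind=> b; elim/Wind=> c; rewrite !WaddE; apply/WpiP/WaddA.
Qed.
Fact Waddr_comm : commutative Wadd.
Proof. by elim/Wind=> a; elim/Wind=> b; rewrite !WaddE; apply/WpiP/WaddC. Qed.
Fact Wadd0r : left_id Wzero Wadd.
Proof. by elim/Wind=> a; rewrite !WaddE; apply/WpiP/Wadd0. Qed.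
Fact WaddNr : left_inverse Wzero Wopp Wadd.
Proof. by elim/Wind=> a; rewrite WoppE WaddE; apply/WpiP/WaddN. Qed.

HB.instance Definition _ :=
  GRing.isZmodule.Build W Waddr_assoc Waddr_comm Wadd0r WaddNr.

Fact Wmulr_assoc : associative Wmul.
Proof.
by elim/Wind=> a; elim/Wind=> b; elim/Wind=> c; rewrite !WmulE; apply/WpiP/WmulA.
Qed.
Fact Wmul1r : left_id Wone Wmul.
Proof. by elim/Wind=> a; rewrite !WmulE; apply/WpiP/Wmul1. Qed.
Fact Wmulr1 : right_id Wone Wmul.
Proof.
by elim/Wind=> a; rewrite !WmulE; apply/WpiP/(Wtrans _ (Wmul1 a))/Wsym/WcstC.
Qed.
Fact Wmulrdl : left_distributive Wmul Wadd.
Proof.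
elim/Wind=> a; elim/Wind=> b; elim/Wind=> c.
by rewrite !(WaddE, WmulE); apply/WpiP/WmulDl.
Qed.
Fact Wmulrdr : right_distributive Wmul Wadd.
Proof.
elim/Wind=> a; elim/Wind=> b; elim/Wind=> c.
by rewrite !(WaddE, WmulE); apply/WpiP/WmulDr.
Qed.

(* Evaluation at x_i = y_k = 0. *)
Fixpoint Wconst (a : expr) : K :=
  match a with
  | WGen _ => 0
  | WCst s => s
  | WAdd b c => Wconst b + Wconst c
  | WMul b c => Wconst b * Wconst c
  end.

Lemma Wconst_cong a b : Wcong a b -> Wconst a = Wconst b.
Proof.
elim=> //=.
- by move=> ? ? ? _ -> _ ->.
- by move=> ? ? ? ? _ -> _ ->.
- by move=> ? ? ? ? _ -> _ ->.
- by move=> *; rewrite addrA.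
- by move=> *; rewrite addrC.
- by move=> *; rewrite add0r.
- by move=> *; rewrite mulN1r addNr.
- by move=> *; rewrite mulrA.
- by move=> *; rewrite mul1r.
- by move=> *; rewrite mulrDl.
- by move=> *; rewrite mulrDr.
- by move=> *; rewrite mulrC.
- by move=> *; rewrite !mulr0.
Qed.

Fact Wone_neq0 : Wone != Wzero :> W.
Proof. by apply/eqP=> /Wpi_cong/Wconst_cong /= /eqP; rewrite oner_eq0. Qed.

HB.instance Definition _ := GRing.Zmodule_isNzRing.Build W
  Wmulr_assoc Wmul1r Wmulr1 Wmulrdl Wmulrdr Wone_neq0.

Fact WscaleA s t (w : W) : Wscale s (Wscale t w) = Wscale (s * t) w.
Proof.
elim/Wind: w => a; rewrite !WscaleE; apply/WpiP.
by apply: Wtrans (WmulA _ _ _) _; apply: WcongM (Wrefl _); apply/Wsym/WcstM.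
Qed.
Fact Wscale1 : left_id 1 Wscale.
Proof. by elim/Wind=> a; rewrite WscaleE; apply/WpiP/Wmul1. Qed.
Fact WscaleDr : right_distributive Wscale +%R.
Proof.
move=> s; elim/Wind=> a; elim/Wind=> b.
by rewrite /GRing.add /= !(WaddE, WscaleE); apply/WpiP/WmulDr.
Qed.
Fact WscaleDl (w : W) : {morph Wscale^~ w : s t / s + t}.
Proof.
move=> s t; elim/Wind: w => a; rewrite {2}/GRing.add /= !WscaleE WaddE.
apply/WpiP; apply: Wtrans (WmulDl _ _ _).
by apply: WcongM (Wrefl _); apply: WcstD.
Qed.

HB.instance Definition _ := GRing.Zmodule_isLmodule.Build K W
  WscaleA Wscale1 WscaleDr WscaleDl.

Lemma WpiD a b : Wpi (WAdd a b) = Wpi a + Wpi b.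
Proof. by rewrite -WaddE. Qed.
Lemma WpiM a b : Wpi (WMul a b) = Wpi a * Wpi b.
Proof. by rewrite -WmulE. Qed.
Lemma WpiZ s a : Wpi (WMul (cst s) a) = s *: Wpi a.
Proof. by rewrite -WscaleE. Qed.

Fact WscaleAl (s : K) (u v : W) : s *: (u * v) = s *: u * v.
Proof.
elim/Wind: u => a; elim/Wind: v => b.
by rewrite -!(WpiZ, WpiM); apply/WpiP/WmulA.
Qed.

HB.instance Definition _ := GRing.Lmodule_isLalgebra.Build K W WscaleAl.

Fact WscaleAr (s : K) (u v : W) : s *: (u * v) = u * (s *: v).
Proof.
elim/Wind: u => a; elim/Wind: v => b; rewrite -!(WpiZ, WpiM); apply/WpiP.
apply: Wtrans (WmulA _ _ _) _; apply: Wtrans (Wsym (WmulA _ _ _)).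
by apply: WcongM (Wrefl _); apply: WcstC.
Qed.

HB.instance Definition _ := GRing.Lalgebra_isAlgebra.Build K W WscaleAr.

Definition Wgen (g : gen m n) : W := Wpi (WGen g).

Lemma WpiC s : Wpi (cst s) = s%:A.
Proof.
rewrite [RHS]WscaleE; apply/WpiP/Wsym.
by apply: Wtrans (WcstC _ _) _; apply: Wmul1.
Qed.

Lemma WgenC (g h : gen m n) :
  Wgen g * Wgen h = (-1) ^+ (gpar g && gpar h) * (Wgen h * Wgen g).
Proof.
rewrite /Wgen -!WpiM; case: g h => [i|k] [j|l] /=; rewrite ?expr0 ?expr1 ?mul1r.
- exact/WpiP/WxxC.
- exact/WpiP/WxyC.
- exact/WpiP/Wsym/WxyC.
- by rewrite mulN1r -scaleN1r [RHS]WscaleE; apply/WpiP/WyyN.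
Qed.

(* true is the odd parity. *)
Inductive Whomog : bool -> W -> Prop :=
  | Whomog_gen g : Whomog (gpar g) (Wgen g)
  | Whomog1 : Whomog false 1
  | Whomog0 p : Whomog p 0
  | WhomogD p u v : Whomog p u -> Whomog p v -> Whomog p (u + v)
  | WhomogZ p s u : Whomog p u -> Whomog p (s *: u)
  | WhomogM p q u v : Whomog p u -> Whomog q v -> Whomog (p (+) q) (u * v).

(* The parity automorphism of W, multiplying the homogeneous elements of       *)
(* parity p by (-1) ^+ p.                                                      *)
Fixpoint Wsgn_expr (a : expr) : W :=
  match a with
  | WGen g => (-1) ^+ gpar g * Wgen g
  | WCst s => s%:A
  | WAdd b c => Wsgn_expr b + Wsgn_expr c
  | WMul b c => Wsgn_expr b * Wsgn_expr c
  end.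

Definition Wsgn (w : W) : W := Wsgn_expr (repr w).

(* The derivative with respect to the generator g, extended to products by     *)
(* the super-Leibniz rule d(bc) = (db)c + (-1)^(|g||b|) b(dc).                 *)
Fixpoint Wder_expr (g : gen m n) (a : expr) : W :=
  match a with
  | WGen h => (g == h)%:R
  | WCst _ => 0
  | WAdd b c => Wder_expr g b + Wder_expr g c
  | WMul b c => Wder_expr g b * Wpi c
                + (if gpar g then Wsgn (Wpi b) else Wpi b) * Wder_expr g c
  end.

Definition Wder (g : gen m n) (w : W) : W := Wder_expr g (repr w).

Lemma Wsgn_cong a b : Wcong a b -> Wsgn_expr a = Wsgn_expr b.
Proof.
elim=> //=.
- by move=> ? ? ? _ -> _ ->.
- by move=> ? ? ? ? _ -> _ ->.
- by move=> ? ? ? ? _ -> _ ->.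
- by move=> *; rewrite addrA.
- by move=> *; rewrite addrC.
- by move=> *; rewrite scale0r add0r.
- by move=> *; rewrite scaleN1r mulN1r addNr scale0r.
- by move=> *; rewrite mulrA.
- by move=> *; rewrite scale1r mul1r.
- by move=> *; rewrite mulrDl.
- by move=> *; rewrite mulrDr.
- by move=> *; rewrite scalerDl.
- by move=> *; rewrite -scalerAl mul1r scalerA.
- by move=> *; rewrite -scalerAl -scalerAr mul1r mulr1.
- by move=> i j; rewrite !mul1r WgenC /= mul1r.
- by move=> i k; rewrite !mul1r !mulN1r mulrN WgenC /= mul1r mulNr.
- by move=> k l; rewrite scaleN1r !expr1 !mulN1r !mulrNN WgenC expr1 mulN1r.
Qed.

Lemma Wsgn_pi a : Wsgn (Wpi a) = Wsgn_expr a.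
Proof. exact/Wsgn_cong/Wrepr_cong. Qed.

Lemma WsgnD u v : Wsgn (u + v) = Wsgn u + Wsgn v.
Proof.
by elim/Wind: u => a; elim/Wind: v => b; rewrite -WpiD !Wsgn_pi.
Qed.
Lemma WsgnM u v : Wsgn (u * v) = Wsgn u * Wsgn v.
Proof.
by elim/Wind: u => a; elim/Wind: v => b; rewrite -WpiM !Wsgn_pi.
Qed.
Lemma WsgnA s : Wsgn s%:A = s%:A.
Proof. by rewrite -WpiC Wsgn_pi /= WpiC. Qed.
Lemma WsgnZ s u : Wsgn (s *: u) = s *: Wsgn u.
Proof. by rewrite -mulr_algl WsgnM WsgnA mulr_algl. Qed.
Lemma Wsgn_gen g : Wsgn (Wgen g) = (-1) ^+ gpar g * Wgen g.
Proof. exact: Wsgn_pi. Qed.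

Lemma Wsgn_homog p w : Whomog p w -> Wsgn w = (-1) ^+ p * w.
Proof.
elim=> {p w}.
- exact: Wsgn_gen.
- by rewrite mul1r -(scale1r 1) WsgnA.
- by move=> p; rewrite mulr0 -(scale0r 1) WsgnA.
- by move=> p u v _ hu _ hv; rewrite WsgnD hu hv mulrDr.
- by move=> p s u _ hu; rewrite WsgnZ hu scalerAr.
- move=> p q u v _ hu _ hv; rewrite WsgnM hu hv signr_addb.
  rewrite -!mulrA; congr (_ * _); rewrite !mulrA; congr (_ * _).
  exact: commr_sign.
Qed.

Lemma Wder_cong g a b : Wcong a b -> Wder_expr g a = Wder_expr g b.
Proof.
pose s (w : W) := if gpar g then Wsgn w else w.
have sD u v : s (u + v) = s u + s v by rewrite /s; case: ifP; rewrite ?WsgnD.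
have sM u v : s (u * v) = s u * s v by rewrite /s; case: ifP; rewrite ?WsgnM.
have sA c : s c%:A = c%:A by rewrite /s; case: ifP; rewrite ?WsgnA.
elim=> {a b} //=; rewrite -/(s _).
- by move=> ? ? ? _ -> _ ->.
- by move=> ? ? ? ? _ -> _ ->.
- by move=> a a' b b' /WpiP-> -> /WpiP-> ->.
- by move=> *; rewrite addrA.
- by move=> *; rewrite addrC.
- by move=> *; rewrite add0r.
- move=> a; rewrite mul0r add0r -/(s _) WpiC sA.
  by rewrite scaleN1r mulN1r addNr.
- move=> a b c; rewrite -!/(s _) !WpiM sM !mulrDr !mulrDl !mulrA addrA.
  by rewrite -/(s _).
- by move=> a; rewrite -/(s _) WpiC sA mul0r add0r scale1r mul1r.
- move=> a b c; rewrite -!/(s _) WpiD sD !mulrDl addrACA //.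
- move=> a b c; rewrite -!/(s _) WpiD !mulrDr addrACA //.
- by move=> *; rewrite addr0.
- by move=> *; rewrite mul0r mulr0 addr0.
- move=> c a; rewrite -!/(s _) WpiC sA mul0r add0r mulr0 addr0.
  by rewrite -scalerAl -scalerAr mul1r mulr1.
- move=> i j; rewrite -!/(s _) -!/(Wgen _).
  have sx k : s (Wgen (inl k)) = Wgen (inl k).
    by rewrite /s; case: ifP => // _; rewrite Wsgn_gen mul1r.
  by rewrite !sx mulr_natl mulr_natr mulr_natl mulr_natr addrC.
- move=> i k; rewrite -!/(s _) -!/(Wgen _).
  have sx j : s (Wgen (inl j)) = Wgen (inl j).
    by rewrite /s; case: ifP => // _; rewrite Wsgn_gen mul1r.
  rewrite sx; case: (eqVneq g (inl i)) => [gi|_].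
    rewrite /s gi /=; rewrite mul1r mulr1 mulr0 addr0.
    by rewrite mul0r add0r.
  by rewrite mul0r add0r mulr0 addr0 mulr_natr mulr_natl.
- move=> k l; rewrite -!/(s _) -!/(Wgen _) WpiC sA mul0r add0r scaleN1r mulN1r.
  rewrite /s; case: g {s sD sM sA} => [i|j].
    by rewrite !mulr0n !mul0r !mulr0 !addr0 oppr0.
  rewrite !Wsgn_gen !expr1 !mulN1r !mulNr opprD opprK addrC.
  by rewrite !mulr_natl !mulr_natr.
Qed.

Lemma Wder_pi g a : Wder g (Wpi a) = Wder_expr g a.
Proof. exact/Wder_cong/Wrepr_cong. Qed.

Lemma WderD g u v : Wder g (u + v) = Wder g u + Wder g v.
Proof.
by elim/Wind: u => a; elim/Wind: v => b; rewrite -WpiD !Wder_pi.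
Qed.
Lemma WderM g u v :
  Wder g (u * v) = Wder g u * v + (if gpar g then Wsgn u else u) * Wder g v.
Proof.
by elim/Wind: u => a; elim/Wind: v => b; rewrite -WpiM !Wder_pi.
Qed.
Lemma WderA g s : Wder g s%:A = 0.
Proof. by rewrite -WpiC Wder_pi. Qed.
Lemma Wder1 g : Wder g 1 = 0.
Proof. by rewrite -(scale1r 1) WderA. Qed.
Lemma Wder_gen g h : Wder g (Wgen h) = (g == h)%:R.
Proof. exact: Wder_pi. Qed.

Lemma Wder_genM g h w :
  Wder g (Wgen h * w)
  = (g == h)%:R * w + (-1) ^+ (gpar g && gpar h) * (Wgen h * Wder g w).
Proof.
rewrite WderM Wder_gen; congr (_ + _); case: ifP => _.
  by rewrite Wsgn_gen mulrA.
by rewrite mul1r.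
Qed.

Lemma Wsgn1 : Wsgn 1 = 1.
Proof. by have := WsgnA 1; rewrite scale1r. Qed.
Lemma Wsgn0 : Wsgn 0 = 0.
Proof. by have := WsgnA 0; rewrite scale0r. Qed.
Lemma WsgnN u : Wsgn (- u) = - Wsgn u.
Proof. by apply/eqP; rewrite -addr_eq0 -WsgnD addNr Wsgn0. Qed.
Lemma Wder0 g : Wder g 0 = 0.
Proof. by have := WderA g 0; rewrite scale0r. Qed.
Lemma WderN g u : Wder g (- u) = - Wder g u.
Proof. by apply/eqP; rewrite -addr_eq0 -WderD addNr Wder0. Qed.
Lemma WderZ g s u : Wder g (s *: u) = s *: Wder g u.
Proof.
rewrite -mulr_algl WderM WderA mul0r add0r WsgnA.
by case: ifP; rewrite mulr_algl.
Qed.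

Lemma Wder_sgn g w : Wder g (Wsgn w) = (-1) ^+ gpar g * Wsgn (Wder g w).
Proof.
elim/Wind: w; elim=> [h|s|a IHa b IHb|a IHa b IHb].
- rewrite Wsgn_gen Wder_gen.
  have -> : Wder g ((-1) ^+ gpar h * Wgen h) = (-1) ^+ gpar h * (g == h)%:R.
    by case: (gpar h); rewrite ?expr1 ?expr0 ?mulN1r ?mul1r ?WderN Wder_gen.
  by case: eqVneq => [->|_]; rewrite ?Wsgn1 // Wsgn0 !mulr0.
- by rewrite WpiC WsgnA WderA Wsgn0 mulr0.
- by rewrite WpiD WsgnD !WderD IHa IHb WsgnD mulrDr.
- rewrite WpiM WsgnM !WderM WsgnD !WsgnM IHa IHb mulrDr.
  by case: (gpar g); rewrite ?expr1 ?expr0 ?mul1r ?mulN1r // mulrN mulNr.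
Qed.

Lemma WderC g h w :
  Wder g (Wder h w) = (-1) ^+ (gpar g && gpar h) * Wder h (Wder g w).
Proof.
elim/Wind: w; elim=> [k|s|a IHa b IHb|a IHa b IHb].
- rewrite !Wder_gen; have Z l (b : bool) : Wder l b%:R = 0.
    by case: b; rewrite ?Wder1 // Wder0.
  by rewrite !Z mulr0.
- by rewrite WpiC !WderA !Wder0 mulr0.
- by rewrite WpiD !WderD IHa IHb mulrDr.
- rewrite WpiM !WderM !WderD !WderM IHa IHb.
  case: (gpar g) (gpar h) (Wder_sgn g (Wpi a)) (Wder_sgn h (Wpi a)) => [] [];
    rewrite /= ?expr1 ?expr0 => eg eh;
    rewrite ?eg ?eh ?mulN1r ?mul1r ?mulNr ?opprD ?opprK ?mulrN -!addrA.
  all: by congr (_ + _); rewrite ?opprK addrCA.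
Qed.

End WQuotient.

Arguments Wgen {K m n}.
Arguments Wder {K m n}.

Section Operators.
Variables (K : comNzRingType) (m n : nat) (mu : K).
Local Notation W := (W K m n).

Definition mul_gen (g : gen m n) : W -> W := fun w => Wgen g * w.

(* None for the index 1, Some (inl i) for i = 2, ..., m, and Some (inr k) for  *)
(* m + k.                                                                      *)
Definition idx (i : 'I_(m + n)) : option (gen m n) :=
  match fintype.split i with
  | inl a => omap inl (insub a : option (even_idx m))
  | inr k => Some (inr k)
  end.

Definition e11 : W -> W :=
  mu *: idfun
  - \sum_(s : even_idx m) (mul_gen (inl s) \o Wder (inl s))
  - \sum_(t < n) (mul_gen (inr t) \o Wder (inr t)).

Definition eop (i j : 'I_(m + n)) : W -> W :=
  match idx i, idx j with
  | None, None => e11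
  | Some g, None => mul_gen g
  | None, Some h => e11 \o Wder h
  | Some g, Some h => mul_gen g \o Wder h
  end.

Definition phi (A : 'M[K]_(m + n)) : W -> W :=
  \sum_(i < m + n) \sum_(j < m + n) A i j *: eop i j.

Lemma phi_delta i j : phi (delta_mx i j) = eop i j.
Proof.
rewrite /phi (bigD1 i) //= (bigD1 j) //= !mxE !eqxx scale1r.
rewrite big1 ?addr0 => [|k /negPf kj]; last by rewrite !mxE kj andbF scale0r.
rewrite big1 ?addr0 // => k /negPf ki.
by rewrite big1 // => l _; rewrite !mxE ki scale0r.
Qed.

End Operators.

Section SuperHom.
Variables (K : comNzRingType) (m n : nat).

Definition ord_par (i : 'I_(m + n)) : bool := (m <= i)%N.

Definition gl_homog (p : bool) (A : 'M[K]_(m + n)) : Prop :=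
  forall i j, A i j != 0 -> ord_par i (+) ord_par j = p.

(* Supercommutators of homogeneous elements of parities p and q. *)
Definition gl_bracket (p q : bool) (A B : 'M[K]_(m + n)) : 'M[K]_(m + n) :=
  A *m B - (-1) ^+ (p && q) *: (B *m A).

Definition end_bracket (V : lmodType K) (p q : bool) (f g : V -> V) : V -> V :=
  f \o g - (-1) ^+ (p && q) *: (g \o f).

Definition end_homog (V : lmodType K) (Vhomog : bool -> V -> Prop) (p : bool)
    (f : V -> V) : Prop :=
  forall q v, Vhomog q v -> Vhomog (p (+) q) (f v).

(* The superspace V is given with the predicates of its homogeneous parts.     *)
(* The brackets are bilinear extensions of their values on homogeneous         *)
(* elements, so it is enough to compare them there.                            *)
Definition lie_superalgebra_hom (V : lmodType K) (Vhomog : bool -> V -> Prop)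
    (f : 'M[K]_(m + n) -> V -> V) : Prop :=
  [/\ forall A, linear (f A),
      linear f,
      forall p A, gl_homog p A -> end_homog Vhomog p (f A)
    & forall p q A B, gl_homog p A -> gl_homog q B ->
        f (gl_bracket p q A B) = end_bracket p q (f A) (f B)].

End SuperHom.

(* Main.v *)
(* Extend the generators by a symbol 0 for the index 1, with L_g =
   multiplication by g, L_0 = e_11 and D_g = d/dg, D_0 = id; then e_ij = L_i D_j for all i, j.
   Since e_11 is mu minus the Euler operator, with eps the sign rule,
     D_j L_k = eps_jk L_k D_j + delta_jk - delta_k0 D_j,
     L_i L_k = eps_ik L_k L_i + delta_k0 L_i - delta_i0 L_k,
     D_j D_l = eps_jl D_l D_j,
   and in the supercommutator of L_i D_j and L_k D_l the terms with delta_k0 or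
   delta_i0 cancel. *)
From HB Require Import structures.
Require Import Defs.
From mathcomp Require Import all_boot all_algebra reals complex.
From mathcomp Require Import boolp functions.

Set Implicit Arguments.
Unset Strict Implicit.
Unset Printing Implicit Defensive.

Import GRing.Theory.
Local Open Scope ring_scope.

(** * Rearrangement of fourfold sums *)

Lemma sum4C (I : finType) (V : nmodType) (F : I -> I -> I -> I -> V) :
  \sum_k \sum_l \sum_i \sum_j F i j k l
  = \sum_i \sum_j \sum_k \sum_l F i j k l.
Proof.
rewrite (eq_bigr _ (fun k _ => exchange_big _ _ _ _ _ _)) exchange_big /=.
apply: eq_bigr => i _.
by rewrite (eq_bigr _ (fun k _ => exchange_big _ _ _ _ _ _)) exchange_big.
Qed.

Lemma sum4B (K : pzRingType) (I : finType) (V : lmodType K) (s : K)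
    (F G : I -> I -> I -> I -> V) :
  \sum_i \sum_j \sum_k \sum_l F i j k l
    - s *: (\sum_i \sum_j \sum_k \sum_l G i j k l)
  = \sum_i \sum_j \sum_k \sum_l (F i j k l - s *: G i j k l).
Proof. by do 4!(rewrite scaler_sumr -sumrB; apply: eq_bigr => ? _). Qed.

Section Module.
Variables (K : comNzRingType) (m n : nat) (mu : K).
Local Notation W := (W K m n).
Local Notation e11 := (@e11 K m n mu).
Local Notation phi := (@phi K m n mu).

(** * The operator [e11] and its commutation with generators and derivatives *)

Lemma e11E (w : W) :
  e11 w = mu *: w - \sum_(g : gen m n) Wgen g * Wder g w.
Proof.
rewrite /e11 /mul_gen big_sumType /= opprD addrA.
have sumfE (I : finType) (F : I -> W -> W) :
    (\sum_(i : I) F i) w = \sum_(i : I) F i w.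
  by elim/big_rec2: _ => // i y1 y2 _ <-.
have subE (f g : W -> W) : (f - g) w = f w - g w by [].
by rewrite !subE !sumfE.
Qed.

Fact Wder_linear (g : gen m n) : linear (@Wder K m n g).
Proof. by move=> s u v; rewrite WderD WderZ. Qed.
HB.instance Definition _ (g : gen m n) :=
  GRing.isLinear.Build K W W _ (@Wder K m n g) (Wder_linear g).

Fact e11_linear : linear e11.
Proof.
move=> s u v; rewrite !e11E scalerDr scalerA mulrC -scalerA scalerBr.
rewrite addrACA -opprD; congr (_ - _).
rewrite scaler_sumr -big_split; apply: eq_bigr => g _ /=.
by rewrite linearP mulrDr scalerAr.
Qed.
HB.instance Definition _ := GRing.isLinear.Build K W W _ e11 e11_linear.

Lemma WgenZC (g h : gen m n) (w : W) :
  Wgen g * (Wgen h * w) = (-1) ^+ (gpar g && gpar h) *: (Wgen h * (Wgen g * w)).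
Proof. by rewrite mulrA WgenC -!mulrA mulr_sign scaler_sign. Qed.

(** Moving [Wgen h] to the left past [Wder g] and then past [Wgen g] gives the same sign twice, so
    the Euler terms commute with [Wgen h] except for one extra term at [g = h]. *)
Lemma e11_gen (h : gen m n) (w : W) :
  e11 (Wgen h * w) = Wgen h * e11 w - Wgen h * w.
Proof.
have term g : Wgen g * Wder g (Wgen h * w)
    = Wgen h * (Wgen g * Wder g w) + (if g == h then Wgen h * w else 0).
  rewrite Wder_genM mulrDr addrC [in RHS]WgenZC andbC mulr_sign scaler_sign.
  congr (_ + _); first by case: ifP => _; rewrite ?mulrN.
  by case: eqP => [->|_]; rewrite ?mul1r // mul0r mulr0.
rewrite !e11E (eq_bigr _ (fun g _ => term g)) big_split -mulr_sumr /=.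
by rewrite -big_mkcond big_pred1_eq mulrBr scalerAr opprD addrA.
Qed.

(** Dual to [e11_gen]: [Wder h] passes [Wgen g] and then [Wder g] with equal signs, and only [g = h]
    leaves a correction. *)
Lemma Wder_e11 (h : gen m n) (w : W) :
  Wder h (e11 w) = e11 (Wder h w) - Wder h w.
Proof.
have term g : Wder h (Wgen g * Wder g w)
    = Wgen g * Wder g (Wder h w) + (if g == h then Wder h w else 0).
  rewrite Wder_genM addrC WderC andbC !mulr_sign eq_sym.
  congr (_ + _); first by case: (_ && _); rewrite ?mulrN ?opprK.
  by case: eqP => [->|_]; rewrite ?mul1r ?mul0r.
rewrite !e11E linearB linearZ linear_sum /= (eq_bigr _ (fun g _ => term g)).
by rewrite big_split -big_mkcond /= big_pred1_eq opprD addrA.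
Qed.

(** * Factorization of the operators and exchange rules for the factors *)

Definition opar (o : option (gen m n)) : bool := oapp (@gpar m n) false o.

(** These are the operators L, with [None] as the symbol 0; [lower] gives the operators D. *)
Definition raise (o : option (gen m n)) : W -> W :=
  if o is Some g then mul_gen g else e11.

Definition lower (o : option (gen m n)) : W -> W :=
  if o is Some g then Wder g else idfun.

Fact raise_linear o : linear (raise o).
Proof.
case: o => [g|] s u v; last exact: linearP.
by rewrite /= /mul_gen mulrDr scalerAr.
Qed.
HB.instance Definition _ o :=
  GRing.isLinear.Build K W W _ (raise o) (raise_linear o).

Fact lower_linear o : linear (lower o).
Proof. by case: o => [g|] s u v //; apply: linearP. Qed.
HB.instance Definition _ o :=
  GRing.isLinear.Build K W W _ (lower o) (lower_linear o).

Lemma eopE i j (w : W) : eop mu i j w = raise (idx i) (lower (idx j) w).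
Proof. by rewrite /eop; case: (idx i) (idx j) => [g|] [h|]. Qed.

Lemma lower_raise j k (w : W) :
  lower j (raise k w) = (-1) ^+ (opar j && opar k) *: raise k (lower j w)
    + (j == k)%:R *: w - (k == None)%:R *: lower j w.
Proof.
case: j k => [g|] [h|] /=; rewrite ?andbF ?scale1r ?scale0r ?subr0 ?addr0 //.
- rewrite Wder_genM addrC scaler_nat mulr_natl mulr_sign scaler_sign //.
- exact: Wder_e11.
(* For [j = k = None] the two corrections are [w] and [- w]. *)
- by rewrite addrK.
Qed.

Lemma raiseC i k (w : W) :
  raise i (raise k w) = (-1) ^+ (opar i && opar k) *: raise k (raise i w)
    + (k == None)%:R *: raise i w - (i == None)%:R *: raise k w.
Proof.
case: i k => [g|] [h|] /=;
  rewrite ?andbF ?scale1r ?scale0r ?subr0 ?addr0 ?addrK //.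
- exact: WgenZC.
- by rewrite /mul_gen e11_gen subrK.
- exact: e11_gen.
Qed.

Lemma lowerC j l (w : W) :
  lower j (lower l w) = (-1) ^+ (opar j && opar l) *: lower l (lower j w).
Proof.
case: j l => [g|] [h|] /=; rewrite ?andbF ?scale1r //.
by rewrite WderC mulr_sign scaler_sign.
Qed.

Lemma raise_lower_raise i j k (w : W) :
  raise i (lower j (raise k w))
  = (-1) ^+ (opar j && opar k) *: raise i (raise k (lower j w))
    + (j == k)%:R *: raise i w - (k == None)%:R *: raise i (lower j w).
Proof.
rewrite lower_raise (linearB (raise i)) (linearD (raise i)).
by rewrite !(linearZ_LR (raise i)).
Qed.

(** This is the supercommutator of two matrix units, carried over to the operators. Both products
    reduce to a common part [X] plus one Kronecker term each. *)
Lemma raise_lower_bracket i j k l (w : W) :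
  let eps := (-1) ^+ ((opar i (+) opar j) && (opar k (+) opar l)) in
  raise i (lower j (raise k (lower l w)))
    - eps *: raise k (lower l (raise i (lower j w)))
  = (j == k)%:R *: raise i (lower l w)
    - eps *: ((l == i)%:R *: raise k (lower j w)).
Proof.
move=> eps; pose sjk : K := (-1) ^+ (opar j && opar k).
(* [X] is what remains of the first product once its factors are brought into the order L_k L_i D_j
   D_l, without the term in [j == k]. *)
pose X : W := (sjk * (-1) ^+ (opar i && opar k))
  *: raise k (raise i (lower j (lower l w)))
  - (i == None)%:R *: (sjk *: raise k (lower j (lower l w))).
have -> : raise i (lower j (raise k (lower l w)))
    = X + (j == k)%:R *: raise i (lower l w).
  rewrite raise_lower_raise raiseC addrAC; congr (_ + _).
  rewrite scalerBr scalerDr /X -(scalerA sjk) addrAC -/sjk.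
  rewrite [sjk *: ((i == None)%:R *: _)]scalerA [sjk * _]mulrC -(scalerA _ sjk).
  (* The two terms with [k == None] cancel: they vanish unless [k = None], and then [sjk] is 1. *)
  congr (_ - _); rewrite /sjk; case: (k) => [g|] /=.
    by rewrite !scale0r scaler0 addr0 subr0.
  by rewrite andbF !scale1r addrK.
have -> : eps *: raise k (lower l (raise i (lower j w)))
    = X + eps *: ((l == i)%:R *: raise k (lower j w)).
  rewrite raise_lower_raise addrAC scalerDr; congr (_ + _).
  rewrite (lowerC l j) (linearZ_LR (raise i)) (linearZ_LR (raise k)).
  rewrite (linearZ_LR (raise k)) scalerBr /X /eps /sjk !scalerA.
  rewrite [_ * (i == None)%:R]mulrC -!mulrA -!signr_addb.
  (* Writing the letters for parities, the signs agree since (i+j)(k+l) + li + lj = ik + jk mod 2.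
     The term with [i == None] survives only for i even, where j(k+l) + lj = jk. *)
  case: (i) => [g|].
    rewrite !mul0r !scale0r; congr (_ *: _ - _).
    by case: (opar _) (opar j) (opar k) (opar l) => [] [] [] [].
  congr (_ *: _ - (_ * _) *: _).
    by case: (opar j) (opar k) (opar l) => [] [] [].
  by case: (opar j) (opar k) (opar l) => [] [] [].
by rewrite opprD addrACA subrr add0r.
Qed.

(** * Passage from matrix indices to symbols *)

Lemma opar_idx (i : 'I_(m + n)) : opar (idx i) = ord_par i.
Proof.
rewrite /idx /ord_par; case: split_ordP => [a ->|k ->] /=.
  by rewrite leqNgt ltn_ord; case: insub.
by rewrite leq_addr.
Qed.

(** Lets the Kronecker deltas on symbols be read as those on matrix indices. *)
Lemma idx_inj : injective (@idx m n).
Proof.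
move=> i j; rewrite /idx.
case: split_ordP => [a ->|k ->]; case: split_ordP => [b ->|l ->] //=.
- case: insubP => [u _ ua|]; case: insubP => [v _ vb|] //=.
  + by case=> uv; rewrite -ua -vb uv.
  (* Only the index 0 is sent to [None]. *)
  + rewrite -!eqn0Ngt => /eqP b0 /eqP a0 _; congr lshift.
    by apply: ord_inj; rewrite a0 b0.
- by case: insubP.
- by case: insubP.
- by case=> ->.
Qed.

(** * Linearity of [phi], in the vector and in the matrix *)

Lemma phiE A (w : W) :
  phi A w = \sum_i \sum_j A i j *: raise (idx i) (lower (idx j) w).
Proof.
rewrite /Defs.phi fct_sumE; apply: eq_bigr => i _.
by rewrite fct_sumE; apply: eq_bigr => j _; rewrite -eopE.
Qed.

Fact phi_linear A : linear (phi A).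
Proof.
move=> s u v; rewrite !phiE scaler_sumr -big_split; apply: eq_bigr => i _ /=.
rewrite scaler_sumr -big_split; apply: eq_bigr => j _ /=.
by rewrite (linearP (lower _)) (linearP (raise _)) scalerDr !scalerA mulrC.
Qed.
HB.instance Definition _ A :=
  GRing.isLinear.Build K W W _ (phi A) (phi_linear A).

Lemma linear_phi : linear phi.
Proof.
move=> s A B; apply/funext => w.
rewrite -[RHS]/(s *: phi A w + phi B w) !phiE.
rewrite scaler_sumr -big_split; apply: eq_bigr => i _ /=.
rewrite scaler_sumr -big_split; apply: eq_bigr => j _ /=.
by rewrite !mxE scalerDl scalerA.
Qed.

(** * Compatibility with parity *)

Lemma WhomogN p (w : W) : Whomog p w -> Whomog p (- w).
Proof. by rewrite -scaleN1r; apply: WhomogZ. Qed.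

Lemma Whomog_sum p (I : finType) (F : I -> W) :
  (forall i, Whomog p (F i)) -> Whomog p (\sum_i F i).
Proof. by move=> hF; elim/big_rec: _ => *; [apply: Whomog0|apply: WhomogD]. Qed.

Lemma Whomog_Wder g q (w : W) :
  Whomog q w -> Whomog (gpar g (+) q) (Wder g w).
Proof.
elim=> {q w} [h||q|q u v _ hu _ hv|q s u _ hu|p q u v hu hdu hv hdv].
- rewrite Wder_gen; case: eqVneq => [->|_]; last exact: Whomog0.
  by rewrite addbb; apply: Whomog1.
- by rewrite Wder1; apply: Whomog0.
- by rewrite Wder0; apply: Whomog0.
- by rewrite WderD; apply: WhomogD.
- by rewrite WderZ; apply: WhomogZ.
- rewrite WderM addbA; apply: WhomogD; first exact: WhomogM.
  rewrite [_ (+) p]addbC -addbA; apply: WhomogM => //.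
  (* On a homogeneous element [Wsgn] is a sign, so the parity of [u] is kept. *)
  case: ifP => // _; rewrite (Wsgn_homog hu) mulr_sign.
  by case: (p) hu => // /WhomogN.
Qed.

Lemma Whomog_raise o q (w : W) :
  Whomog q w -> Whomog (opar o (+) q) (raise o w).
Proof.
have mulP g p u : Whomog p u -> Whomog (gpar g (+) p) (Wgen g * u).
  by apply: WhomogM; apply: Whomog_gen.
move=> hw; case: o => [g|] /=; first exact: mulP.
rewrite e11E; apply: WhomogD; first exact: WhomogZ.
apply/WhomogN/Whomog_sum => g.
(* The derivative and the multiplication each add the parity of [g], so [e11] is even. *)
by rewrite -[q](addKb (gpar g)); apply/mulP/Whomog_Wder.
Qed.

Lemma Whomog_lower o q (w : W) :
  Whomog q w -> Whomog (opar o (+) q) (lower o w).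
Proof. by case: o => [g|] //; apply: Whomog_Wder. Qed.

Lemma end_homog_phi p (A : 'M[K]_(m + n)) :
  gl_homog p A -> end_homog (@Whomog K m n) p (phi A).
Proof.
move=> hA q w hw; rewrite phiE; do 2!apply: Whomog_sum => ?.
set i := (i in A i _); set j := (j in A _ j).
have [->|/hA <-] := eqVneq (A i j) 0; first by rewrite scale0r; apply: Whomog0.
rewrite -addbA -!opar_idx.
by apply/WhomogZ/Whomog_raise/Whomog_lower.
Qed.

(** * The bracket relation *)

Lemma phi_comp A B (w : W) :
  phi A (phi B w) = \sum_i \sum_j \sum_k \sum_l
    (A i j * B k l)
      *: raise (idx i) (lower (idx j) (raise (idx k) (lower (idx l) w))).
Proof.
rewrite phiE; apply: eq_bigr => i _; apply: eq_bigr => j _.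
rewrite phiE (linear_sum (lower _)) (linear_sum (raise _)) scaler_sumr.
apply: eq_bigr => k _.
rewrite (linear_sum (lower _)) (linear_sum (raise _)) scaler_sumr.
apply: eq_bigr => l _.
by rewrite (linearZ_LR (lower _)) (linearZ_LR (raise _)) scalerA.
Qed.

(** The Kronecker delta keeps all four indices, so that the sum can be compared with that of
    [phi_comp] term by term. *)
Lemma phi_mulmx (A B : 'M[K]_(m + n)) (w : W) :
  phi (A *m B) w = \sum_i \sum_j \sum_k \sum_l
    (A i j * B k l) *: ((j == k)%:R *: raise (idx i) (lower (idx l) w)).
Proof.
rewrite phiE; apply: eq_bigr => i _.
transitivity
  (\sum_l \sum_j (A i j * B j l) *: raise (idx i) (lower (idx l) w)).
  by apply: eq_bigr => l _; rewrite mxE scaler_suml.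
rewrite exchange_big; apply: eq_bigr => j _ /=.
rewrite [RHS](bigD1 j) //= [X in _ + X]big1 ?addr0.
  by apply: eq_bigr => l _; rewrite eqxx scale1r.
move=> k kj; rewrite big1 // => l _.
by rewrite eq_sym (negPf kj) scale0r scaler0.
Qed.

Lemma phi_bracket p q (A B : 'M[K]_(m + n)) :
  gl_homog p A -> gl_homog q B ->
  phi (gl_bracket p q A B) = end_bracket p q (phi A) (phi B).
Proof.
move=> hA hB; apply/funext => w; set s : K := (-1) ^+ (p && q).
have -> : phi (gl_bracket p q A B) = phi (A *m B) - s *: phi (B *m A).
  by rewrite /gl_bracket addrC -scaleNr linear_phi addrC scaleNr.
rewrite -[LHS]/(phi (A *m B) w - s *: phi (B *m A) w).
rewrite -[RHS]/(phi A (phi B w) - s *: phi B (phi A w)).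
(* The sums for the opposite order are reindexed so that [A] carries [i j] and [B] carries [k l]
   throughout. *)
rewrite !phi_mulmx !phi_comp !(sum4C (fun i j k l => (B k l * A i j) *: _)).
rewrite !sum4B.
apply: eq_bigr => i _; apply: eq_bigr => j _.
apply: eq_bigr => k _; apply: eq_bigr => l _.
rewrite [B k l * _]mulrC.
rewrite !(scalerA s (A i j * B k l)) [s * _]mulrC -!(scalerA _ s) -!scalerBr.
(* Zero entries make both sides vanish; nonzero ones force [p] and [q] to be the parities of the
   matrix units, so [s] becomes the sign in [raise_lower_bracket]. *)
have [->|/hA ijp] := eqVneq (A i j) 0; first by rewrite mul0r !scale0r.
have [->|/hB klq] := eqVneq (B k l) 0; first by rewrite mulr0 !scale0r.
rewrite /s -ijp -klq -!opar_idx raise_lower_bracket.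
by rewrite !(inj_eq idx_inj).
Qed.

End Module.

Theorem theorem2p1 (R : realType) (m n : nat) (hm : (0 < m)%N) (mu : R[i]) :
  lie_superalgebra_hom (@Whomog R[i] m n) (@phi R[i] m n mu).
Proof.
split; first exact: phi_linear.
- exact: linear_phi.
- exact: end_homog_phi.
- exact: phi_bracket.
Qed.
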